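(* Let $X$ and $Y$ be regular vector fields on $G/K$ corresponding to the maps $\Phi$ and $\Psi$ in $\mathrm{Ind}_K^G(\sigma)$, respectively. Then the commutator $[X,Y]=XY-YX$ corresponds to the map $\Phi\circledast\Psi$ defined by $$\Phi\circledast\Psi(g)=d\Psi_g(g\Phi(g))-d\Phi_g(g\Psi(g)),\qquad g\in G.$$
   Context: $G\subset \mathrm{GL}(N,\mathbf C)$ is a connected complex reductive linear algebraic group, $\theta$ an involutive automorphism of $G$, $K=G^\theta$, and $\mathfrak g=\mathfrak k+\mathfrak p$ the decomposition of the Lie algebra of $G$ into the $\pm1$-eigenspaces of (the differential of) $\theta$. $\mathbf C[G/K]$ is identified with the right $K$-invariant regular functions on $G$. Let $\sigma$ be the isotropy representation ($\mathrm{Ad}$) of $K$ on $\mathfrak p$ and $\mathrm{Ind}_K^G(\sigma)$ the space of regular maps $\Phi:G\to\mathfrak p$ with $\Phi(gk)=\sigma(k)^{-1}\Phi(g)$ for all $k\in K$, $g\in G$. Regular algebraic vector fields $X$ on $G/K$ correspond bijectively to $\Phi\in\mathrm{Ind}_K^G(\sigma)$ via $Xf(g)=\frac{d}{dt}f(g(1+t\Phi(g)))|_{t=0}$ for $f\in\mathbf C[G/K]$ ($f$ viewed as the restriction to $G$ of a regular function on $\mathrm{GL}(N,\mathbf C)$). Here $gX$ ($g\in G$, $X\in\mathfrak g$) is the matrix product, so that $g\Phi(g)\in T_gG$, and $d\Psi_g:T_gG\to\mathfrak p$ is the differential of $\Psi$ at $g$. *)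

(* Defs.v *)
From HB Require Import structures.
From mathcomp Require Import all_boot all_order all_algebra.
From mathcomp Require Import boolp classical_sets functions reals.
From mathcomp Require Import topology normedtype derive.
From mathcomp Require Import complex.
(* [mpoly] is not imported, as its notations clash with those of analysis. *)
From mathcomp Require mpoly.

Set Implicit Arguments.
Unset Strict Implicit.
Unset Printing Implicit Defensive.

Import Order.TTheory GRing.Theory Num.Theory.
Import numFieldNormedType.Exports.

Local Open Scope classical_set_scope.
Local Open Scope ring_scope.

(* C is any field in which limits make sense (so that ['D_v] and [derive1] are
   the C-linear, i.e. holomorphic, derivatives); the theorem takes C := R[i]
   for R : realType. *)

Section RegularFunctions.
Variables (C : numFieldType) (N : nat).
Local Notation M := 'M[C]_N.

(* C[GL_N] = C[x_ij, 1/det]; the values of F outside GL_N are irrelevant. *)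
Definition regular_GL (F : M -> C) : Prop :=
  exists (p : mpoly.mpoly (N * N) C) (m : nat), forall g : M, g \in unitmx ->
    F g = mpoly.meval (fun i => mxvec g 0 i) p / \det g ^+ m.

Definition regular_GL_mx (F : M -> M) : Prop :=
  forall i j, regular_GL (fun g => F g i j).

Definition zariski_closed (A : set M) : Prop :=
  exists S : set (M -> C), S `<=` regular_GL /\
    A = [set g | g \in unitmx /\ forall F, S F -> F g = 0].

Definition zariski_connected (A : set M) : Prop :=
  forall A1 A2, zariski_closed A1 -> zariski_closed A2 ->
    A = A1 `|` A2 -> A1 `&` A2 = set0 -> A1 = set0 \/ A2 = set0.

(* Linear algebraic groups G in GL(N, C). *)
Record algGroup := AlgGroup {
  alg_set :> set M;
  alg_closed : zariski_closed alg_set;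
  alg_1 : alg_set 1%:M;
  alg_M : forall g h, alg_set g -> alg_set h -> alg_set (g *m h);
  alg_V : forall g, alg_set g -> alg_set (invmx g) }.

Definition unipotent (u : M) : Prop := exists n, (u - 1%:M) ^+ n = 0.

(* The unipotent radical is trivial. *)
Definition reductive (G : algGroup) : Prop :=
  forall U : algGroup, U `<=` G -> zariski_connected U ->
    (forall g u, alg_set G g -> alg_set U u ->
      alg_set U (g *m u *m invmx g)) ->
    U `<=` unipotent -> U `<=` [set 1%:M].

End RegularFunctions.

Record points (C : numFieldType) (N : nat) (G : algGroup C N) := Point {
  point_mx :> 'M[C]_N;
  point_mem : point_mx \in alg_set G }.
Arguments Point {C N G} point_mx point_mem.

HB.instance Definition _ C N (G : algGroup C N) :=
  [isSub for @point_mx C N G].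
HB.instance Definition _ C N (G : algGroup C N) :=
  [Choice of points G by <:].

Section PointsGroup.
Variables (C : numFieldType) (N : nat) (G : algGroup C N).
Implicit Types g h : points G.

Lemma points_in g : alg_set G g.
Proof. exact: set_mem (point_mem g). Qed.

Lemma points_unit g : (g : 'M_N) \in unitmx.
Proof.
by have [S [_ defG]] := alg_closed G; have := points_in g; rewrite {1}defG; case.
Qed.

Definition points_one : points G := Point 1%:M (mem_set (alg_1 G)).
Definition points_mul g h : points G :=
  Point (g *m h) (mem_set (alg_M (points_in g) (points_in h))).
Definition points_inv g : points G :=
  Point (invmx g) (mem_set (alg_V (points_in g))).

Lemma points_mulA : associative points_mul.
Proof. by move=> g h k; apply: val_inj; rewrite /= mulmxA. Qed.
Lemma points_mul1 : left_id points_one points_mul.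
Proof. by move=> g; apply: val_inj; rewrite /= mul1mx. Qed.
Lemma points_mulr1 : right_id points_one points_mul.
Proof. by move=> g; apply: val_inj; rewrite /= mulmx1. Qed.
Lemma points_mulV : left_inverse points_one points_inv points_mul.
Proof. by move=> g; apply: val_inj; rewrite /= mulVmx ?points_unit. Qed.
Lemma points_mulrV : right_inverse points_one points_inv points_mul.
Proof. by move=> g; apply: val_inj; rewrite /= mulmxV ?points_unit. Qed.

HB.instance Definition _ := isGroup.Build (points G)
  points_mulA points_mul1 points_mulr1 points_mulV points_mulrV.

End PointsGroup.

Section SymmetricSpace.
Variables (C : numFieldType) (N : nat) (G : algGroup C N).
Local Notation M := 'M[C]_N.
Local Notation pG := (points G).

(* F is a regular function on GL_N restricting to f on G. *)
Definition extends (F : M -> C) (f : pG -> C) : Prop :=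
  regular_GL F /\ forall g : pG, F g = f g.

Definition extends_mx (F : M -> M) (Psi : pG -> M) : Prop :=
  regular_GL_mx F /\ forall g : pG, F g = Psi g.

Definition regular_mx (Psi : pG -> M) : Prop := exists F, extends_mx F Psi.

(* d Psi_g (v); for v in T_g G it does not depend on the chosen extension. *)
Definition diff_mx (Psi : pG -> M) (g : pG) (v : M) : M :=
  'D_v (xget (fun=> 0) [set F | extends_mx F Psi]) g.

Definition lie_algebra : set M :=
  [set A | forall F : M -> C, regular_GL F -> (forall g : pG, F g = 0) ->
    'D_A (F : M -> C^o) 1%:M = 0].

Definition involutive_automorphism (theta : pG -> pG) : Prop :=
  [/\ {morph theta : g h / (g * h)%g}, involutive theta
    & regular_mx (fun g : pG => theta g : M)].

Section Involution.
Variable theta : pG -> pG.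

Definition fixed_group : set pG := [set k | theta k = k].

Definition lie_p : set M :=
  [set A | lie_algebra A /\
    diff_mx (fun g : pG => theta g : M) (1%g : pG) A = - A].

(* C[G/K] *)
Definition regular_GK (f : pG -> C) : Prop :=
  (exists F, extends F f) /\
  (forall g k : pG, fixed_group k -> f (g * k)%g = f g).

(* G/K is affine, so its regular vector fields are the C-linear derivations of
   C[G/K]; what X does outside C[G/K] is irrelevant. *)
Definition vector_field (X : (pG -> C) -> pG -> C) : Prop :=
  [/\ forall f, regular_GK f -> regular_GK (X f),
      forall (a : C) f h, regular_GK f -> regular_GK h ->
        X (a \*o f \+ h) = a \*o X f \+ X h
    & forall f h, regular_GK f -> regular_GK h ->
        X (f \* h) = (X f \* h) \+ (f \* X h)].

Definition isotropy (k : pG) (A : M) : M := k *m A *m (k^-1)%g.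

(* Ind_K^G(sigma), with sigma = Ad of K on p; sigma(k)^-1 = sigma(k^-1). *)
Definition induced (Phi : pG -> M) : Prop :=
  [/\ regular_mx Phi, forall g, lie_p (Phi g)
    & forall g k, fixed_group k -> Phi (g * k)%g = isotropy k^-1%g (Phi g)].

Definition corresponds (X : (pG -> C) -> pG -> C) (Phi : pG -> M) : Prop :=
  [/\ vector_field X, induced Phi &
      forall f F, regular_GK f -> extends F f -> forall g : pG,
        X f g = derive1
          (fun t : C => F (g *m (1%:M + t *: Phi g)) : C^o) 0].

End Involution.

Definition commutator (X Y : (pG -> C) -> pG -> C) : (pG -> C) -> pG -> C :=
  fun f => X (Y f) \- Y (X f).

Definition circledast (Phi Psi : pG -> M) : pG -> M := fun g =>
  diff_mx Psi g (g *m Phi g) - diff_mx Phi g (g *m Psi g).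

End SymmetricSpace.

(* Main.v *)
(* Let [lderiv A F] be the derivative of F along the left-invariant field
   g |-> g A; then [lderiv A, lderiv B] = lderiv [A, B].  If X and Y correspond
   to Phi and Psi, differentiating (Y f)(g) = lderiv (Psi g) F g along
   A = Phi(g), with B = Psi(g), gives
     (XY f)(g) = lderiv (dPsi_g(gA)) F g + lderiv A (lderiv B F) g,
   so [X, Y] differs from the field of the bracket of Phi and Psi by
   lderiv [A, B] F g.  Since theta acts by -1 on p, [A, B] is fixed by dtheta,
   and what remains is that a right K-invariant f is killed by it.  For this one
   needs actual points of K tangent to C = [A, B], namely exp(tC): a regular F
   has along exp(tC) the Taylor coefficients (lderiv C)^n F (1) / n!, and these
   vanish if F vanishes on G, or if F is an entry of theta(g) - g.  Hence
   exp(tC) lies in G and is fixed by theta, and f(g exp(tC)) = f(g) is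
   differentiated at t = 0.
   Values in p and K-equivariance of the bracket hold because both conditions
   are linear in dPsi_g and hold for Psi. *)

Require Import Defs.
From HB Require Import structures.
From mathcomp Require Import all_boot all_order all_algebra.
From mathcomp Require Import boolp classical_sets functions reals.
From mathcomp Require Import topology normedtype sequences derive exp.
From mathcomp Require Import complex ring lra.
From mathcomp Require mpoly.
Import (canonicals) mpoly.

Set Implicit Arguments.
Unset Strict Implicit.
Unset Printing Implicit Defensive.

Import Order.TTheory GRing.Theory Num.Theory.
Import numFieldNormedType.Exports.

Local Open Scope classical_set_scope.
Local Open Scope ring_scope.

(** * Regular functions on GL_N *)

Section RegularCalculus.
Variables (C : numFieldType) (N : nat).
Local Notation M := 'M[C]_N.
Implicit Types (F H : M -> C) (g v A B : M).

Definition mx_entry (i j : 'I_N) : M -> C := fun g => g i j.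

Definition poly_fun (F : M -> C) : Prop :=
  exists p : mpoly.mpoly (N * N) C,
    forall g, F g = mpoly.meval (fun i => mxvec g 0 i) p.

Lemma poly_fun_cst (c : C) : poly_fun (fun=> c).
Proof. by exists (mpoly.mpolyC _ c) => g; rewrite mpoly.mevalC. Qed.

Lemma poly_fun_entry i j : poly_fun (mx_entry i j).
Proof.
exists (mpoly.mpolyX C (mpoly.mnm1 (mxvec_index i j))) => g.
by rewrite mpoly.mevalXU mxvecE.
Qed.


Lemma poly_funD F H : poly_fun F -> poly_fun H -> poly_fun (F \+ H).
Proof.
by move=> [p Fp] [q Hq]; exists (p + q) => g; rewrite /= Fp Hq rmorphD.
Qed.

Lemma poly_funM F H : poly_fun F -> poly_fun H -> poly_fun (F \* H).
Proof.
by move=> [p Fp] [q Hq]; exists (p * q) => g; rewrite /= Fp Hq rmorphM.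
Qed.

Lemma poly_fun_sum (I : Type) (r : seq I) (F_ : I -> M -> C) :
  (forall i, poly_fun (F_ i)) -> poly_fun (fun g => \sum_(i <- r) F_ i g).
Proof.
move=> pF; elim: r => [|i r IHr].
  by under eq_fun do rewrite big_nil; apply: poly_fun_cst.
by under eq_fun do rewrite big_cons; apply: poly_funD.
Qed.

Lemma poly_fun_det m : poly_fun (fun g => \det g ^+ m).
Proof.
exists (\det (\matrix_(i < N, j < N)
          mpoly.mpolyX C (mpoly.mnm1 (mxvec_index i j))) ^+ m) => g.
rewrite rmorphXn -det_map_mx; congr (\det _ ^+ _).
by apply/matrixP => i j; rewrite !mxE /= mpoly.mevalXU mxvecE.
Qed.

(** A polynomial is a sum of scaled monomials, and a monomial is a product of powers of entries.
    Later proofs argue on functions through this principle and never return to the syntax of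
    [mpoly]. *)
Lemma poly_fun_ind (Q : (M -> C) -> Prop) :
  (forall c, Q (fun=> c)) -> (forall i j, Q (mx_entry i j)) ->
  (forall F H, poly_fun F -> poly_fun H -> Q F -> Q H -> Q (F \+ H)) ->
  (forall F H, poly_fun F -> poly_fun H -> Q F -> Q H -> Q (F \* H)) ->
  forall F, poly_fun F -> Q F.
Proof.
move=> Qc Qx QD QM.
pose ev (p : mpoly.mpoly (N * N) C) g := mpoly.meval (fun i => mxvec g 0 i) p.
have pev p : poly_fun (ev p) by exists p.
suff Qp : forall p, Q (ev p).
  by move=> F [p Fp]; rewrite (_ : F = ev p) //; apply/funext.
have evC c : ev (mpoly.mpolyC _ c) = fun=> c.
  by apply/funext => g; apply: mpoly.mevalC.
have ev1 : ev 1 = fun=> 1 by apply/funext => g; apply: rmorph1.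
have QevM p q : Q (ev p) -> Q (ev q) -> Q (ev (p * q)).
  move=> Qp Qq; rewrite (_ : ev _ = ev p \* ev q); first exact: QM.
  by apply/funext => g; apply: rmorphM.
have Qexp p k : Q (ev p) -> Q (ev (p ^+ k)).
  by elim: k => [|k IHk] Qp; rewrite ?expr0 ?ev1 // exprS; apply: QevM; auto.
elim/mpoly.mpolyind => [|c m p _ _ IH].
  by rewrite (_ : ev 0 = fun=> 0) //; apply/funext => g; apply: rmorph0.
rewrite (_ : ev _ = ev (c *: mpoly.mpolyX C m) \+ ev p); last first.
  by apply/funext => g; apply: rmorphD.
apply: QD => //; rewrite -mpoly.mul_mpolyC; apply: (QevM); first by rewrite evC.
rewrite mpoly.mpolyXE_id; apply: (big_ind (fun p => Q (ev p))) => //.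
  by rewrite ev1.
move=> ij _; apply: (Qexp); case/mxvec_indexP: ij => i j.
rewrite (_ : ev _ = mx_entry i j) //; apply/funext => g.
by rewrite /ev mpoly.mevalXU mxvecE.
Qed.

Lemma regular_GLP F : regular_GL F <->
  exists2 P, poly_fun P & exists m, forall g, g \in unitmx ->
    F g = P g / \det g ^+ m.
Proof.
split=> [[p [m Fp]]|[P [p Pp] [m FP]]].
  exists (fun g => mpoly.meval (fun i => mxvec g 0 i) p); first by exists p.
  by exists m.
by exists p, m => g gU; rewrite FP // Pp.
Qed.

Lemma poly_fun_regular F : poly_fun F -> regular_GL F.
Proof.
by move=> pF; apply/regular_GLP; exists F => //; exists 0 => g; rewrite divr1.
Qed.

Lemma regular_GL_ext F H :
  (forall g, g \in unitmx -> F g = H g) -> regular_GL F -> regular_GL H.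
Proof. by move=> FH [p [m Fp]]; exists p, m => g gU; rewrite -FH // Fp. Qed.

Lemma det_neq0 g : g \in unitmx -> \det g != 0.
Proof. by rewrite unitmxE unitfE. Qed.

(** Clearing the denominator: Taylor bounds are proved for polynomial functions only, and this
    carries them over to regular ones. *)
Lemma regular_GL_clear F : regular_GL F ->
  exists2 P, poly_fun P & exists m, forall g, g \in unitmx ->
    P g = \det g ^+ m * F g.
Proof.
case/regular_GLP=> P pP [m FP]; exists P => //; exists m => g gU.
by rewrite FP // mulrCA divff ?mulr1 // expf_neq0 // det_neq0.
Qed.

Lemma regular_cst (c : C) : regular_GL (fun _ : M => c).
Proof. exact/poly_fun_regular/poly_fun_cst. Qed.

Lemma regular_entry i j : regular_GL (mx_entry i j).
Proof. exact/poly_fun_regular/poly_fun_entry. Qed.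

Lemma regularD F H : regular_GL F -> regular_GL H -> regular_GL (F \+ H).
Proof.
case/regular_GLP=> P pP [m FP] /regular_GLP[Q pQ [n HQ]]; apply/regular_GLP.
exists ((P \* fun g => \det g ^+ n) \+ (Q \* fun g => \det g ^+ m)).
  by apply: poly_funD; apply: poly_funM => //; apply: poly_fun_det.
exists (m + n)%N => g gU; rewrite /= FP // HQ //.
have m0 : \det g ^+ m != 0 by rewrite expf_neq0 // det_neq0.
have n0 : \det g ^+ n != 0 by rewrite expf_neq0 // det_neq0.
by rewrite exprD addf_div.
Qed.

Lemma regularM F H : regular_GL F -> regular_GL H -> regular_GL (F \* H).
Proof.
case/regular_GLP=> P pP [m FP] /regular_GLP[Q pQ [n HQ]]; apply/regular_GLP.
exists (P \* Q); first exact: poly_funM.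
by exists (m + n)%N => g gU; rewrite /= FP // HQ // exprD mulf_div.
Qed.

Lemma regularZ (c : C) F : regular_GL F -> regular_GL (c \*o F).
Proof. by move=> rF; apply: regularM rF; apply: regular_cst. Qed.

Lemma regularN F : regular_GL F -> regular_GL (\- F).
Proof.
by move/(regularZ (-1)); apply: regular_GL_ext => g _; rewrite /= mulN1r.
Qed.

Lemma regularB F H : regular_GL F -> regular_GL H -> regular_GL (F \- H).
Proof. by move=> rF rH; apply: regularD => //; apply: regularN. Qed.

Lemma regular_sum (I : Type) (r : seq I) (F_ : I -> M -> C) :
  (forall i, regular_GL (F_ i)) -> regular_GL (fun g => \sum_(i <- r) F_ i g).
Proof.
move=> rF; elim: r => [|i r IHr].
  by under eq_fun do rewrite big_nil; apply: regular_cst.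
by under eq_fun do rewrite big_cons; apply: regularD.
Qed.

Lemma regular_det m : regular_GL (fun g => \det g ^+ m).
Proof. exact/poly_fun_regular/poly_fun_det. Qed.

Lemma regular_detV : regular_GL (fun g => (\det g)^-1).
Proof.
apply/regular_GLP; exists (fun=> 1); first exact: poly_fun_cst.
by exists 1%N => g _; rewrite div1r.
Qed.

(** The first clause accounts for the arbitrary values outside GL_N. The inverse clause is applied
    to the determinant, and the powers of 1/det then come from the product clause. *)
Lemma regular_ind (Q : (M -> C) -> Prop) :
  (forall F H, (forall g, g \in unitmx -> F g = H g) -> Q F -> Q H) ->
  (forall c, Q (fun=> c)) -> (forall i j, Q (mx_entry i j)) ->
  (forall F H, regular_GL F -> regular_GL H -> Q F -> Q H -> Q (F \+ H)) ->
  (forall F H, regular_GL F -> regular_GL H -> Q F -> Q H -> Q (F \* H)) ->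
  (forall F, regular_GL F -> regular_GL (fun g => (F g)^-1) ->
    (forall g, g \in unitmx -> F g != 0) -> Q F -> Q (fun g => (F g)^-1)) ->
  forall F, regular_GL F -> Q F.
Proof.
move=> Qe Qc Qx QD QM QV F /regular_GLP[P pP [m FP]].
have polyQ : forall H, poly_fun H -> Q H.
  by apply: poly_fun_ind => // G H /poly_fun_regular ? /poly_fun_regular ?;
    [apply: QD|apply: QM].
have QdetV : Q (fun g => (\det g)^-1).
  have pdet := poly_fun_det 1; apply: QV => //.
  - exact: poly_fun_regular.
  - exact: regular_detV.
  - exact: det_neq0.
  - exact: polyQ.
have [rX QX] : regular_GL (fun g => (\det g)^-1 ^+ m) /\
               Q (fun g => (\det g)^-1 ^+ m).
  elim: m {FP} => [|m [rm Qm]].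
    by under eq_fun do rewrite expr0; split; [apply: regular_cst|apply: Qc].
  under eq_fun do rewrite exprS.
  have rdV := regular_detV.
  by split; [apply: regularM rm|apply: QM].
apply: Qe (QM _ _ (poly_fun_regular pP) rX (polyQ _ pP) QX) => g gU /=.
by rewrite FP // exprVn.
Qed.

End RegularCalculus.

(** * Left-invariant derivations *)

Section Derivations.
Variables (C : numFieldType) (N : nat).
Local Notation M := 'M[C]_N.
Implicit Types (F H : M -> C) (g v A B : M).

Lemma poly_fun_continuous F : poly_fun F -> continuous (F : M -> C^o).
Proof.
move: F; apply: poly_fun_ind => [c|i j|F H _ _ cF cH|F H _ _ cF cH] g.
- exact: cst_continuous.
- exact: coord_continuous.
- exact: cvgD (cF g) (cH g).
- exact: cvgM (cF g) (cH g).
Qed.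

(** GL_N is open because the determinant is continuous; hence a derivative at a point of GL_N does
    not see values outside it. *)
Lemma near_unitmx g : g \in unitmx -> \forall h \near g, h \in unitmx.
Proof.
move=> gU; have /(_ g)cdet := poly_fun_continuous (poly_fun_det C N 1).
have := cvgr_neq0 _ cdet; rewrite expr1 det_neq0 // => /(_ _ isT).
by apply: filterS => h; rewrite expr1 unitmxE unitfE.
Qed.

Lemma is_derive_ext F H g v (d : C) : g \in unitmx ->
  (forall h, h \in unitmx -> F h = H h) ->
  is_derive g v (F : M -> C^o) d -> is_derive g v (H : M -> C^o) d.
Proof.
move=> gU FH; apply: near_eq_is_derive.
by apply: filterS (near_unitmx gU) => h /FH.
Qed.

Lemma derive_ext F H g v : g \in unitmx ->
  (forall h, h \in unitmx -> F h = H h) ->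
  'D_v (F : M -> C^o) g = 'D_v (H : M -> C^o) g.
Proof.
move=> gU FH; apply: near_eq_derive.
by apply: filterS (near_unitmx gU) => h /FH.
Qed.

Lemma is_derive_linear F g v :
  (forall a u w, F (a *: u + w) = a * F u + F w) ->
  is_derive g v (F : M -> C^o) (F v).
Proof.
move=> Flin; have cv : (fun h => h^-1 *: (((F : M -> C^o) \o shift g) (h *: v)
    - F g)) @ 0^' --> (F v : C^o).
  (* By linearity the difference quotient equals [F v] for every nonzero h. *)
  apply: cvg_near_cst.
  near=> h; rewrite /= Flin addrK [LHS]mulrA mulVf ?mul1r //.
  by near: h; exact: nbhs_dnbhs_neq.
by apply: DeriveDef; [apply/cvg_ex; exists (F v)|apply: cvg_lim cv].
Unshelve. all: by end_near. Qed.

Lemma is_derive_entry i j g v :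
  is_derive g v (mx_entry i j : M -> C^o) (v i j).
Proof. by apply: is_derive_linear => a u w; rewrite /mx_entry !mxE. Qed.

(** One induction, by the sum, product and quotient rules, yields differentiability, linearity in
    the direction, and regularity of the partial derivatives [d i j]. *)
Lemma regular_gradient F : regular_GL F ->
  exists2 d : 'I_N -> 'I_N -> M -> C, (forall i j, regular_GL (d i j)) &
    forall g v, g \in unitmx ->
      is_derive g v (F : M -> C^o) (\sum_i \sum_j v i j * d i j g).
Proof.
move: F; apply: regular_ind.
- move=> F H FH [d rd dF]; exists d => // g v gU.
  exact: is_derive_ext FH (dF g v gU).
- move=> c; exists (fun _ _ _ => 0) => [i j|g v gU]; first exact: regular_cst.
  rewrite big1; first exact: is_derive_cst.
  by move=> i _; rewrite big1 // => j _ /=; rewrite mulr0.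
- move=> i j; exists (fun k l _ => ((k == i) && (l == j))%:R) => [k l|g v gU].
    exact: regular_cst.
  rewrite (bigD1 i) //= [X in _ + X]big1 ?addr0; last first.
    by move=> k /negPf ki; rewrite big1 // => l _; rewrite ki mulr0.
  rewrite (bigD1 j) //= !eqxx mulr1 big1 ?addr0; first exact: is_derive_entry.
  by move=> l /negPf lj; rewrite lj mulr0.
- move=> F H rF rH [d rd dF] [e re eH].
  exists (fun i j => d i j \+ e i j) => [i j|g v gU]; first exact: regularD.
  apply: is_derive_eq (is_deriveD (dF g v gU) (eH g v gU)) _.
  rewrite -big_split; apply: eq_bigr => i _ /=; rewrite -big_split.
  by apply: eq_bigr => j _; rewrite /= mulrDr.
- move=> F H rF rH [d rd dF] [e re eH].
  exists (fun i j => (F \* e i j) \+ (H \* d i j)) => [i j|g v gU].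
    by apply: regularD; apply: regularM.
  apply: is_derive_eq (is_deriveM (dF g v gU) (eH g v gU)) _.
  rewrite !scaler_sumr -big_split; apply: eq_bigr => i _ /=.
  rewrite !scaler_sumr -big_split; apply: eq_bigr => j _ /=.
  by rewrite /GRing.scale /=; ring.
- move=> F rF rFV F0 [d rd dF].
  exists (fun i j =>
    \- (((fun g => (F g)^-1) \* (fun g => (F g)^-1)) \* d i j)).
    by move=> i j; apply/regularN/regularM => //; apply: regularM.
  move=> g v gU; have [Fd FD] := dF g v gU.
  apply: DeriveDef; first by apply: derivableV; rewrite ?F0.
  rewrite deriveV ?F0 // FD scaler_sumr; apply: eq_bigr => i _.
  rewrite scaler_sumr; apply: eq_bigr => j _ /=.
  by rewrite /GRing.scale /= expr2 invfM; ring.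
Qed.

Lemma regular_derivable F g v : regular_GL F -> g \in unitmx ->
  derivable (F : M -> C^o) g v.
Proof. by case/regular_gradient=> d _ dF gU; have [] := dF g v gU. Qed.

Lemma regular_deriveP F g v w (a : C) : regular_GL F -> g \in unitmx ->
  'D_(a *: v + w) (F : M -> C^o) g =
  a * 'D_v (F : M -> C^o) g + 'D_w (F : M -> C^o) g.
Proof.
case/regular_gradient=> d _ dF gU.
rewrite !(derive_val (is_derive := dF _ _ gU)) mulr_sumr -big_split.
apply: eq_bigr => i _; rewrite mulr_sumr -big_split; apply: eq_bigr => j _.
by rewrite /= !mxE mulrDl mulrA.
Qed.

End Derivations.

(* Locked so that [ring] does not unfold limits when comparing atoms. *)
HB.lock Definition lderiv (C : numFieldType) (N : nat) (A : 'M[C]_N)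
    (F : 'M[C]_N -> C) : 'M[C]_N -> C :=
  fun g => 'D_(g *m A) (F : 'M[C]_N -> C^o) g.
Canonical lderiv_unlockable := Unlockable lderiv.unlock.

Section LeftInvariant.
Variables (C : numFieldType) (N : nat).
Local Notation M := 'M[C]_N.
Implicit Types (F H : M -> C) (g v A B : M).

Lemma lderivE A F g : lderiv A F g = 'D_(g *m A) (F : M -> C^o) g.
Proof. by rewrite unlock. Qed.

Lemma lderiv_ext A F H : (forall g, g \in unitmx -> F g = H g) ->
  forall g, g \in unitmx -> lderiv A F g = lderiv A H g.
Proof. by move=> FH g gU; rewrite !lderivE; apply: derive_ext. Qed.

Lemma iter_lderiv_ext A n F H : (forall g, g \in unitmx -> F g = H g) ->
  forall g, g \in unitmx -> iter n (lderiv A) F g = iter n (lderiv A) H g.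
Proof. by move=> FH; elim: n => //= n IHn; apply: lderiv_ext. Qed.

Lemma regular_mulmx_entry A i j : regular_GL (fun g => (g *m A) i j).
Proof.
under eq_fun do rewrite mxE; apply: regular_sum => k.
by apply: regularM; [apply: regular_entry|apply: regular_cst].
Qed.

Lemma regular_lderiv A F : regular_GL F -> regular_GL (lderiv A F).
Proof.
case/regular_gradient=> d rd dF.
have: regular_GL (fun g => \sum_i \sum_j (g *m A) i j * d i j g).
  apply: regular_sum => i; apply: regular_sum => j.
  exact: regularM (regular_mulmx_entry A i j) (rd i j).
apply: regular_GL_ext => g gU.
by rewrite lderivE (derive_val (is_derive := dF _ _ gU)).
Qed.

Lemma regular_iter_lderiv A n F :
  regular_GL F -> regular_GL (iter n (lderiv A) F).
Proof. by move=> rF; elim: n => //= n; apply: regular_lderiv. Qed.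

Lemma lderiv_cst A (c : C) : lderiv A (fun=> c) = fun=> 0.
Proof. by apply/funext => g; rewrite lderivE; apply: derive_cst. Qed.

Lemma lderiv_entry A i j : lderiv A (mx_entry i j) = fun g => (g *m A) i j.
Proof.
apply/funext => g; rewrite lderivE.
by have [_] := is_derive_entry i j g (g *m A).
Qed.

Lemma lderiv_mulmx_entry A B i j :
  lderiv A (fun g => (g *m B) i j) = fun g => (g *m A *m B) i j.
Proof.
have Flin a u w : ((a *: u + w) *m B) i j = a * (u *m B) i j + (w *m B) i j.
  by rewrite mulmxDl -scalemxAl !mxE.
apply/funext => g; rewrite lderivE.
by have [_] := is_derive_linear g (g *m A) Flin.
Qed.

Lemma lderivD A F H g : regular_GL F -> regular_GL H -> g \in unitmx ->
  lderiv A (F \+ H) g = lderiv A F g + lderiv A H g.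
Proof.
by move=> rF rH gU; rewrite !lderivE; apply: deriveD; apply: regular_derivable.
Qed.

Lemma lderivM A F H g : regular_GL F -> regular_GL H -> g \in unitmx ->
  lderiv A (F \* H) g = lderiv A F g * H g + F g * lderiv A H g.
Proof.
move=> rF rH gU; rewrite !lderivE [LHS]deriveM; [|exact: regular_derivable..].
by rewrite addrC [X in X + _]mulrC.
Qed.

Lemma lderivZ A (c : C) F g : regular_GL F -> g \in unitmx ->
  lderiv A (c \*o F) g = c * lderiv A F g.
Proof.
move=> rF gU; rewrite [LHS]lderivM ?lderiv_cst ?mul0r ?add0r //.
exact: regular_cst.
Qed.

Lemma lderivN A F g : regular_GL F -> g \in unitmx ->
  lderiv A (\- F) g = - lderiv A F g.
Proof. by move=> rF gU; rewrite !lderivE; apply/deriveN/regular_derivable. Qed.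

Lemma lderivB A F H g : regular_GL F -> regular_GL H -> g \in unitmx ->
  lderiv A (F \- H) g = lderiv A F g - lderiv A H g.
Proof.
by move=> rF rH gU; rewrite lderivD ?lderivN //; apply: regularN.
Qed.

Lemma lderiv_sum A (I : Type) (r : seq I) (F_ : I -> M -> C) g :
  (forall i, regular_GL (F_ i)) -> g \in unitmx ->
  lderiv A (fun g => \sum_(i <- r) F_ i g) g = \sum_(i <- r) lderiv A (F_ i) g.
Proof.
move=> rF gU; elim: r => [|i r IHr].
  by under eq_fun do rewrite big_nil; rewrite lderiv_cst big_nil.
under eq_fun do rewrite big_cons.
by rewrite big_cons -IHr; apply: lderivD => //; apply: regular_sum.
Qed.

Lemma lderivV A F g : regular_GL F -> F g != 0 -> g \in unitmx ->
  lderiv A (fun h => (F h)^-1) g = - (F g) ^- 2 * lderiv A F g.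
Proof.
move=> rF Fg gU; rewrite !lderivE; apply: deriveV => //.
exact: regular_derivable.
Qed.

Lemma lderivP (a : C) A B F g : regular_GL F -> g \in unitmx ->
  lderiv (a *: A + B) F g = a * lderiv A F g + lderiv B F g.
Proof.
by move=> rF gU; rewrite !lderivE mulmxDr -scalemxAr regular_deriveP.
Qed.

Lemma lderiv0 F g : lderiv 0 F g = 0.
Proof. by rewrite !lderivE mulmx0 derive0. Qed.

Lemma lderivBl A B F g : regular_GL F -> g \in unitmx ->
  lderiv (A - B) F g = lderiv A F g - lderiv B F g.
Proof.
by move=> rF gU; rewrite addrC -scaleN1r lderivP // mulN1r addrC.
Qed.

(** At fixed g the derivative is linear in A. When A varies with g, this rewrites the derivative as
    variable coefficients times fixed left-invariant fields, which can be differentiated again. *)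
Lemma lderiv_delta A F g : regular_GL F -> g \in unitmx ->
  lderiv A F g = \sum_i \sum_j A i j * lderiv (delta_mx i j) F g.
Proof.
move=> rF gU; pose L B := lderiv B F g.
have L0 : L 0 = 0 by apply: lderiv0.
have LD B D : L (B + D) = L B + L D.
  by have := lderivP 1 B D rF gU; rewrite scale1r mul1r.
have LZ a B : L (a *: B) = a * L B.
  by have := lderivP a B 0 rF gU; rewrite addr0 lderiv0 addr0.
rewrite [in LHS](matrix_sum_delta A) -/(L _) (big_morph L LD L0).
apply: eq_bigr => i _; rewrite (big_morph L LD L0).
by apply: eq_bigr => j _; rewrite LZ.
Qed.

(** Both sides are derivations in F, so the identity propagates from the entries, where applying B
    and then A gives the entries of gAB. *)
Lemma lderiv_commutator A B F g : regular_GL F -> g \in unitmx ->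
  lderiv A (lderiv B F) g - lderiv B (lderiv A F) g =
  lderiv (A *m B - B *m A) F g.
Proof.
move=> rF; move: F rF g; apply: regular_ind.
- move=> F H FH IH g gU; apply: etrans (etrans (IH g gU) (lderiv_ext _ FH gU)).
  by congr (_ - _); apply: lderiv_ext gU => h hU; apply/esym/lderiv_ext.
- by move=> c g gU; rewrite !lderiv_cst subrr.
- move=> i j g gU; rewrite !lderiv_entry !lderiv_mulmx_entry.
  by rewrite -!mulmxA -[LHS]/(_ - _) mulmxBr !mxE.
- move=> F H rF rH; move: (A *m B - B *m A) => AB IF IH g gU.
  have e D E : lderiv D (lderiv E (F \+ H)) g =
      lderiv D (lderiv E F) g + lderiv D (lderiv E H) g.
    rewrite -lderivD //; [|exact: regular_lderiv..].
    by apply: lderiv_ext gU => h hU; rewrite lderivD.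
  by rewrite !e lderivD // -IF // -IH //; ring.
- move=> F H rF rH; move: (A *m B - B *m A) => AB IF IH g gU.
  (* The two mixed terms are exchanged when D and E are, so they cancel in the commutator. *)
  have e D E : lderiv D (lderiv E (F \* H)) g =
      lderiv D (lderiv E F) g * H g + lderiv E F g * lderiv D H g +
      (lderiv D F g * lderiv E H g + F g * lderiv D (lderiv E H) g).
    have rE := regular_lderiv E rF; have rE' := regular_lderiv E rH.
    rewrite -!lderivM // -lderivD //; [|exact: regularM..].
    by apply: lderiv_ext gU => h hU; rewrite lderivM.
  by rewrite !e lderivM // -IF // -IH //; ring.
- move=> F rF rFV F0; move: (A *m B - B *m A) => AB IF g gU.
  (* The term in F^-3 is symmetric in D and E and cancels likewise. *)
  have e D E : lderiv D (lderiv E (fun g => (F g)^-1)) g =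
      2 * (F g) ^- 3 * lderiv D F g * lderiv E F g
      - (F g) ^- 2 * lderiv D (lderiv E F) g.
    have rE := regular_lderiv E rF.
    rewrite (_ : lderiv _ _ _ = lderiv D (\- (((fun g => (F g)^-1) \*
      (fun g => (F g)^-1)) \* lderiv E F)) g); last first.
      apply: lderiv_ext gU => h hU.
      by rewrite lderivV ?F0 //= expr2 invfM mulNr.
    rewrite lderivN ?lderivM // ?lderivV ?F0 //;
      [|by do ?apply: regularM..].
    by rewrite !exprS expr0 !invfM !invr1 /=; ring.
  rewrite !e lderivV ?F0 // -IF //.
  by rewrite mulNr; ring.
Qed.

End LeftInvariant.

(** * Translations, curves and iterated derivatives *)

Section Translations.
Variables (C : numFieldType) (N : nat).
Local Notation M := 'M[C]_N.
Implicit Types (F H : M -> C) (g v A B : M).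

(** Multiplicativity of the determinant turns the new denominator into a constant times the old
    one. *)
Lemma regular_translate F a b : a \in unitmx -> b \in unitmx ->
  regular_GL F -> regular_GL (fun g => F (a *m g *m b)).
Proof.
move=> aU bU /regular_GLP[P pP [m FP]].
have : poly_fun (fun g => P (a *m g *m b)).
  move: P pP {FP}; apply: poly_fun_ind => [c|i j|P Q _ _|P Q _ _].
  - exact: poly_fun_cst.
  - rewrite /mx_entry; under eq_fun do rewrite mxE; apply: poly_fun_sum => k.
    apply: poly_funM (poly_fun_cst _ _); under eq_fun do rewrite mxE.
    apply: poly_fun_sum => l.
    exact: poly_funM (poly_fun_cst _ _) (poly_fun_entry _ _ _).
  - exact: poly_funD.
  - exact: poly_funM.
move=> pP'; apply/regular_GLP.
exists ((fun=> (\det a ^+ m * \det b ^+ m)^-1) \* (fun g => P (a *m g *m b))).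
  by apply: poly_funM pP'; apply: poly_fun_cst.
exists m => g gU; rewrite FP ?unitmx_mul ?aU ?gU //= !det_mulmx !exprMn !invfM.
by ring.
Qed.

Lemma derive_translate F a b g v :
  'D_v (fun h => F (a *m h *m b) : C^o) g =
  'D_(a *m v *m b) (F : M -> C^o) (a *m g *m b).
Proof.
rewrite /derive; set f1 := fun h => h^-1 *: _; set f2 := fun h => h^-1 *: _.
suff -> : f1 = f2 by []; apply/funext => h; rewrite /f1 /f2 /=.
by rewrite mulmxDr mulmxDl -scalemxAr -scalemxAl.
Qed.

(** Since g(1 + tA) = g + t gA, the two difference quotients are the same function. This links the
    derivative that defines the correspondence to left-invariant fields. *)
Lemma derive1_curve F g A :
  derive1 (fun t : C => F (g *m (1%:M + t *: A)) : C^o) 0 = lderiv A F g.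
Proof.
rewrite lderivE /derive1 /derive.
set f1 := fun h => h^-1 *: _; set f2 := fun h => h^-1 *: _.
suff -> : f1 = f2 by []; apply/funext => h; rewrite /f1 /f2 /=.
by rewrite addr0 scale0r addr0 mulmx1 mulmxDr mulmx1 -scalemxAr (addrC g).
Qed.

Lemma derive_mxE (F : M -> M) g v i j : regular_GL_mx F -> g \in unitmx ->
  ('D_v F g) i j = 'D_v (fun h => F h i j : C^o) g.
Proof.
move=> rF gU; have dF k l := @regular_derivable _ _ _ g v (rF k l) gU.
suff cv : (fun h => h^-1 *: ((F \o shift g) (h *: v) - F g)) @ 0^' -->
    \matrix_(k, l) 'D_v (fun h => F h k l : C^o) g.
  by rewrite /derive (cvg_lim (@norm_hausdorff _ _) cv) mxE.
(* A neighbourhood of a matrix contains a product of neighbourhoods [P k l] of its entries, and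
   there are finitely many entries. *)
move=> U [P PU sPU] /=.
pose f h := h^-1 *: ((F \o shift g) (h *: v) - F g).
have fP k l : \forall h \near 0^', P k l (f h k l).
  have := PU k l; rewrite mxE => /(dF k l); rewrite nbhs_simpl /=.
  by apply: filterS => h; rewrite /f /= !mxE.
have fPk k : \forall h \near 0^', forall l, P k l (f h k l).
  exact: filter_forall (fP k).
by apply: filterS (filter_forall _ fPk) => h; apply: sPU.
Qed.

Lemma iter_lderivB A n F H g : regular_GL F -> regular_GL H -> g \in unitmx ->
  iter n (lderiv A) (F \- H) g = iter n (lderiv A) F g - iter n (lderiv A) H g.
Proof.
move=> rF rH; elim: n g => //= n IHn g gU.
by rewrite (lderiv_ext A IHn gU) lderivB //; apply: regular_iter_lderiv.
Qed.

Lemma iter_lderivD A n F H g : regular_GL F -> regular_GL H -> g \in unitmx ->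
  iter n (lderiv A) (F \+ H) g = iter n (lderiv A) F g + iter n (lderiv A) H g.
Proof.
move=> rF rH; elim: n g => //= n IHn g gU.
by rewrite (lderiv_ext A IHn gU) lderivD //; apply: regular_iter_lderiv.
Qed.

Lemma iter_lderiv_cst A n (c : C) :
  iter n (lderiv A) (fun=> c) = fun=> if n is 0%N then c else 0.
Proof. by elim: n => //= n ->; rewrite lderiv_cst. Qed.

Lemma iter_lderiv_entry A n i j :
  iter n (lderiv A) (mx_entry i j) = fun g => (g *m A ^+ n) i j.
Proof.
elim: n => [|n IHn] /=.
  by apply/funext => g; rewrite expr0 mulmx1.
rewrite IHn lderiv_mulmx_entry; apply/funext => g.
by rewrite exprS -mulmxA.
Qed.

Lemma iter_lderivM A n F H g : regular_GL F -> regular_GL H -> g \in unitmx ->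
  iter n (lderiv A) (F \* H) g =
  \sum_(k < n.+1)
     (iter k (lderiv A) F g * iter (n - k) (lderiv A) H g) *+ 'C(n, k).
Proof.
move=> rF rH; elim: n g => [|n IHn] g gU.
  by rewrite big_ord1 bin0 mulr1n.
pose f k := iter k (lderiv A) F; pose h k := iter k (lderiv A) H.
have rf k : regular_GL (f k) by apply: regular_iter_lderiv.
have rh k : regular_GL (h k) by apply: regular_iter_lderiv.
pose G k : M -> C := ('C(n, k)%:R \*o (f k \* h (n - k)%N)).
have rG (k : 'I_n.+1) : regular_GL (G k) by apply/regularZ/regularM.
rewrite iterS (lderiv_ext A (H := fun g => \sum_(k < n.+1) G k g)) //;
  last first.
  move=> x xU; rewrite IHn //; apply: eq_bigr => k _.
  by rewrite /G /= mulr_natl.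
rewrite lderiv_sum //.
have -> : \sum_(k < n.+1) lderiv A (G k) g =
    \sum_(k < n.+1) (f k.+1 g * h (n - k)%N g) *+ 'C(n, k) +
    \sum_(k < n.+1) (f k g * h (n - k).+1 g) *+ 'C(n, k).
  rewrite -big_split; apply: eq_bigr => k _.
  rewrite lderivZ //; last exact: regularM.
  by rewrite lderivM // mulr_natl mulrnDl.
(* The index is shifted so that both sums carry the same products and add up by Pascal's rule; the
   extra last term vanishes because 'C(n, n+1) = 0. *)
have -> : \sum_(k < n.+1) (f k g * h (n - k).+1 g) *+ 'C(n, k) =
    f 0%N g * h n.+1 g +
    \sum_(k < n.+1) (f k.+1 g * h (n - k)%N g) *+ 'C(n, k.+1).
  rewrite big_ord_recl bin0 subn0 mulr1n; congr (_ + _).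
  rewrite [RHS]big_ord_recr /= bin_small // mulr0n addr0.
  by apply: eq_bigr => k _; rewrite /bump !add1n -[in RHS](subnSK (ltn_ord k)).
rewrite addrCA -big_split /= [RHS]big_ord_recl bin0 subn0 mulr1n.
congr (_ + _); apply: eq_bigr => k _.
by rewrite lift0 subSS binS mulrnDr addrC.
Qed.

End Translations.

(** * Matrix exponential and Taylor expansions *)

Section ExpCoeff.
Variable R : realType.
Implicit Types (x y : R) (b : R ^nat).

(** The binomial theorem divided by n!. It makes the bounds of two expansions multiply under the
    Cauchy product. *)
Lemma exp_coeffD x y n :
  exp_coeff (x + y) n = \sum_(i < n.+1) exp_coeff x i * exp_coeff y (n - i)%N.
Proof.
rewrite /exp_coeff /= addrC exprDn mulr_suml; apply: eq_bigr => i _.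
have fn0 m : m`!%:R != 0 :> R by rewrite pnatr_eq0 -lt0n fact_gt0.
have ni : (i <= n)%N by rewrite -ltnS.
rewrite -(bin_fact ni) !natrM -[_ *+ 'C(n, i)]mulr_natr.
have b0 : 'C(n, i)%:R != 0 :> R by rewrite pnatr_eq0 -lt0n bin_gt0.
move: b0 (fn0 i) (fn0 (n - i)%N); set c := _%:R; set d := _%:R; set e := _%:R.
move: (y ^+ _) (x ^+ _) => u v c0 d0 e0.
by field; rewrite c0 d0 e0.
Qed.

Lemma exp_coeffMl x y n : exp_coeff (x * y) n = exp_coeff x n * y ^+ n.
Proof. by rewrite /exp_coeff /= exprMn mulrAC. Qed.

Lemma exp_coeff_addn x m n : 0 <= x ->
  exp_coeff x (m + n)%N <= exp_coeff x m * exp_coeff x n.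
Proof.
move=> x0; rewrite /exp_coeff /= mulrACA -exprD -invfM -natrM.
apply: ler_wpM2l; first exact: exprn_ge0.
rewrite lef_pV2 ?posrE ?ltr0n ?muln_gt0 ?fact_gt0 // ler_nat.
(* m! n! is at most (m+n)! because their quotient is a positive binomial coefficient. *)
by rewrite -(bin_fact (leq_addr n m)) addKn leq_pmull // bin_gt0 leq_addr.
Qed.

Lemma exp_coeff_le x y n :
  0 <= x -> x <= y -> exp_coeff x n <= exp_coeff y n.
Proof.
move=> x0 xy; rewrite /exp_coeff /= ler_wpM2r ?invr_ge0 //.
by rewrite lerXn2r // nnegrE // (le_trans x0).
Qed.

Lemma series_exp_coeff_le x n : 0 <= x -> series (exp_coeff x) n <= expR x.
Proof.
move=> x0; apply: nondecreasing_cvgn_le; last exact: is_cvg_series_exp_coeff.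
by apply: nondecreasing_series => k _ _; apply: exp_coeff_ge0.
Qed.

Lemma is_cvg_series_le_exp b x : (forall k, `|b k| <= exp_coeff x k) ->
  cvgn (series b).
Proof.
move=> bx; apply: (normed_cvg (V := R^o)).
apply: (series_le_cvg _ _ bx); last exact: is_cvg_series_exp_coeff.
  by move=> k; apply: normr_ge0.
by move=> k; apply: le_trans (bx k).
Qed.

(** The tail is at most the sum over i of x^(n+i)/(n+i)!, from which x^n/n! factors out, leaving
    partial sums of the exponential series. *)
Lemma series_exp_remainder b x n : 0 <= x ->
  (forall k, `|b k| <= exp_coeff x k) ->
  `|limn (series b) - series b n| <= expR x * exp_coeff x n.
Proof.
move=> x0 bx; have cb := is_cvg_series_le_exp bx.
apply: (cvgr_to_le (F := \oo) (f := fun m => `|series b m - series b n|)).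
  by apply: cvg_norm; apply: cvgB; [exact: cb|exact: cvg_cst].
near=> m; have nm : (n <= m)%N by near: m; apply: nbhs_infty_ge.
rewrite sub_series_geq // (le_trans (ler_norm_sum _ _ _)) //.
rewrite -{1}[n]add0n big_addn.
apply: (@le_trans _ _ (\sum_(0 <= i < m - n) exp_coeff x n * exp_coeff x i)).
  apply: ler_sum => i _; rewrite addnC (le_trans (bx _)) //.
  exact: exp_coeff_addn.
rewrite -mulr_sumr mulrC; apply: ler_wpM2r; first exact: exp_coeff_ge0.
exact: series_exp_coeff_le.
Unshelve. all: by end_near. Qed.

End ExpCoeff.

(** * Functions on [0, 1] with Taylor remainders of exponential type *)

Section Expansions.
Variable R : realType.
Local Notation C := (complex R).
Local Notation normc := (@ComplexField.Normc.normc R).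
Implicit Types (z : C) (t : R) (u v : R -> C) (c d : nat -> C).

Lemma normc_ge0 z : 0 <= normc z.
Proof. by case: z => a b; apply: sqrtr_ge0. Qed.

Lemma normcD z w : normc (z + w) <= normc z + normc w.
Proof. exact: le_normcD. Qed.

Lemma normcN z : normc (- z) = normc z.
Proof. exact: complex.normcN. Qed.

Lemma normc_real t : 0 <= t -> normc (t%:C)%C = t.
Proof. by move=> t0; rewrite /= expr0n addr0 sqrtr_sqr ger0_norm. Qed.

Lemma normc_sum (I : Type) (r : seq I) (F : I -> C) :
  normc (\sum_(i <- r) F i) <= \sum_(i <- r) normc (F i).
Proof.
elim: r => [|i r IHr]; first by rewrite !big_nil ComplexField.Normc.normc0.
by rewrite !big_cons (le_trans (normcD _ _)) // lerD2l.
Qed.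

Lemma normc_le_ReIm z : normc z <= `|complex.Re z| + `|complex.Im z|.
Proof.
case: z => a b /=; rewrite -(ger0_norm (addr_ge0 (normr_ge0 a) (normr_ge0 b))).
rewrite -sqrtr_sqr ler_wsqrtr // sqrrD !real_normK ?num_real //.
by rewrite addrAC lerDl mulrn_wge0 // mulr_ge0.
Qed.

Lemma Re_le_normc z : `|complex.Re z| <= normc z.
Proof.
by case: z => a b /=; rewrite -sqrtr_sqr ler_wsqrtr // lerDl sqr_ge0.
Qed.

Lemma Im_le_normc z : `|complex.Im z| <= normc z.
Proof.
by case: z => a b /=; rewrite -sqrtr_sqr ler_wsqrtr // lerDr sqr_ge0.
Qed.

Definition psum c t n : C := \sum_(k < n) c k * (t%:C)%C ^+ k.

Lemma psumS c t n : psum c t n.+1 = psum c t n + c n * (t%:C)%C ^+ n.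
Proof. exact: big_ord_recr. Qed.

(* The bounds are those of entire functions, so that they hold on all of
   [0, 1] for every polynomial in the entries of exp(tA): a radius depending
   on the polynomial would not do, as G is cut out by infinitely many. *)
Definition expansion u c : Prop := exists M K : R, [/\ 0 <= M, 0 <= K,
  forall n, normc (c n) <= M * exp_coeff K n &
  forall n t, 0 <= t <= 1 ->
    normc (u t - psum c t n) <= M * exp_coeff (K * t) n].

Lemma expansion_cst z :
  expansion (fun=> z) (fun n => if n is 0%N then z else 0).
Proof.
exists (normc z), 0; split => //; first exact: normc_ge0.
  case=> [|n]; first by rewrite /exp_coeff /= expr0 fact0 divr1 mulr1.
  by rewrite ComplexField.Normc.normc0 mulr_ge0 ?normc_ge0 // exp_coeff_ge0.
case=> [|n] t /andP[t0 _].
  by rewrite /psum big_ord0 subr0 /exp_coeff /= expr0 fact0 divr1 mulr1.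
rewrite /psum big_ord_recl expr0 mulr1 big1 ?addr0 ?subrr.
  rewrite ComplexField.Normc.normc0 mulr_ge0 ?normc_ge0 //.
  by rewrite exp_coeff_ge0 // mul0r.
by move=> i _; rewrite mul0r.
Qed.

Lemma expansionD u v c d : expansion u c -> expansion v d ->
  expansion (u \+ v) (fun n => c n + d n).
Proof.
move=> [M [K [M0 K0 cM uM]]] [M' [K' [M'0 K'0 dM vM]]].
have KK : K <= K + K' by rewrite lerDl.
have KK' : K' <= K + K' by rewrite lerDr.
exists (M + M'), (K + K'); split; rewrite ?addr_ge0 // => n.
  rewrite (le_trans (normcD _ _)) // mulrDl lerD //.
    by rewrite (le_trans (cM n)) // ler_wpM2l // exp_coeff_le.
  by rewrite (le_trans (dM n)) // ler_wpM2l // exp_coeff_le.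
move=> t t01; have /andP[t0 _] := t01.
have -> : (u \+ v) t - psum (fun n => c n + d n) t n =
    (u t - psum c t n) + (v t - psum d t n).
  rewrite addrACA -opprD; congr (_ - _); rewrite -big_split.
  by apply: eq_bigr => k _; rewrite /= mulrDl.
rewrite (le_trans (normcD _ _)) // mulrDl lerD //.
  rewrite (le_trans (uM n t t01)) // ler_wpM2l // exp_coeff_le ?mulr_ge0 //.
  exact: ler_wpM2r.
rewrite (le_trans (vM n t t01)) // ler_wpM2l // exp_coeff_le ?mulr_ge0 //.
exact: ler_wpM2r.
Qed.

Definition cauchy_prod c d n : C := \sum_(k < n.+1) c k * d (n - k)%N.

(** Both sides sum c_i d_j t^(i+j) over i + j < n; the right side groups the terms by i. *)
Lemma psum_cauchy_prod c d t n : psum (cauchy_prod c d) t n =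
  \sum_(i < n) c i * (t%:C)%C ^+ i * psum d t (n - i)%N.
Proof.
elim: n => [|n IHn]; first by rewrite /psum !big_ord0.
rewrite psumS IHn /cauchy_prod mulr_suml.
have -> : \sum_(i < n) c i * (t%:C)%C ^+ i * psum d t (n - i)%N =
    \sum_(i < n.+1) c i * (t%:C)%C ^+ i * psum d t (n - i)%N.
  by rewrite [RHS]big_ord_recr /= subnn [psum d t 0]big_ord0 mulr0 addr0.
rewrite -big_split; apply: eq_bigr => i _ /=.
have ni : (i <= n)%N by rewrite -ltnS.
rewrite subSn // psumS mulrDr; congr (_ + _).
have -> : (t%:C)%C ^+ n = (t%:C)%C ^+ i * (t%:C)%C ^+ (n - i).
  by rewrite -exprD subnKC.
by ring.
Qed.

Lemma normc_pow t n : 0 <= t -> normc ((t%:C)%C ^+ n) = t ^+ n.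
Proof. by move=> t0; rewrite -rmorphXn normc_real // exprn_ge0. Qed.

Lemma expansionM u v c d : expansion u c -> expansion v d ->
  expansion (u \* v) (cauchy_prod c d).
Proof.
move=> [M [K [M0 K0 cM uM]]] [M' [K' [M'0 K'0 dM vM]]].
have bound (x y : R) n : M * M' * exp_coeff (x + y) n =
    \sum_(i < n.+1) M * exp_coeff x i * (M' * exp_coeff y (n - i)%N).
  by rewrite exp_coeffD mulr_sumr; apply: eq_bigr => i _; ring.
exists (M * M'), (K + K'); split; rewrite ?addr_ge0 ?mulr_ge0 // => n.
  rewrite bound (le_trans (normc_sum _ _)) //; apply: ler_sum => i _.
  by rewrite ComplexField.Normc.normcM ler_pM ?normc_ge0.
move=> t t01; have /andP[t0 t1] := t01.
(* The remainder splits into remainders of v of order n - i weighted by c_i t^i, plus the remainder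
   of u times v. These n + 1 terms are matched one by one with the sum in [bound]. *)
have -> : (u \* v) t - psum (cauchy_prod c d) t n =
    \sum_(i < n) c i * (t%:C)%C ^+ i * (v t - psum d t (n - i)%N)
    + (u t - psum c t n) * v t.
  rewrite psum_cauchy_prod; under [in RHS]eq_bigr do rewrite mulrBr.
  by rewrite sumrB mulrBl [psum c t n]/psum mulr_suml /=; ring.
rewrite (mulrDl K K' t) bound big_ord_recr (le_trans (normcD _ _)) //= lerD //.
  rewrite (le_trans (normc_sum _ _)) //; apply: ler_sum => i _.
  rewrite !ComplexField.Normc.normcM normc_pow // exp_coeffMl.
  rewrite ler_pM ?mulr_ge0 ?normc_ge0 ?exprn_ge0 ?vM //.
  by rewrite mulrA ler_wpM2r ?exprn_ge0.
rewrite ComplexField.Normc.normcM ler_pM ?normc_ge0 ?uM // subnn.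
(* At order 0 the partial sum is empty, so the remainder bound is a bound on [v t] itself. *)
by have := vM 0%N t t01; rewrite /psum big_ord0 subr0.
Qed.

(** All partial sums vanish, so |u(t)| is at most M (Kt)^n/n! for every n, and this tends to 0. *)
Lemma expansion_eq0 u c : expansion u c -> (forall n, c n = 0) ->
  forall t, 0 <= t <= 1 -> u t = 0.
Proof.
move=> [M [K [M0 K0 _ uM]]] c0 t t01.
apply: ComplexField.Normc.eq0_normc; apply/eqP.
rewrite eq_le normc_ge0 andbT.
have cv : (fun n => M * exp_coeff (K * t) n) @ \oo --> (M * 0 : R).
  by apply: cvgM; [exact: cvg_cst|exact: cvg_exp_coeff].
rewrite -(mulr0 M); apply: cvgr_to_ge cv _; near=> n.
have := uM n t t01; rewrite /psum big1 ?subr0 // => i _.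
by rewrite c0 mul0r.
Unshelve. all: by end_near. Qed.

(** The remainder of order 2 gives |c_1| t <= (M K^2/2) t^2 for small t > 0; divide by t and let t
    tend to 0. *)
Lemma expansion_coef1_eq0 u c r : expansion u c -> 0 < r ->
  (forall t, 0 < t <= r -> u t = 0) -> c 0%N = 0 -> c 1%N = 0.
Proof.
move=> [M [K [M0 K0 _ uM]]] r0 ut0 c0.
apply: ComplexField.Normc.eq0_normc; apply/eqP.
rewrite eq_le normc_ge0 andbT; apply/ler_addgt0Pr => e e0.
rewrite add0r.
pose B := M * K ^+ 2 / 2.
have B0 : 0 <= B by rewrite divr_ge0 ?mulr_ge0 ?exprn_ge0.
(* The minimum keeps t in the ranges of both hypotheses and makes B t at most e; B + 1 is a positive
   divisor even if B = 0. *)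
pose t := Num.min (Num.min r 1) (e / (B + 1)).
have B1 : 0 < B + 1 by rewrite ltr_wpDl.
have t0 : 0 < t by rewrite /t !lt_min r0 ltr01 divr_gt0.
have tr : t <= r by rewrite /t !ge_min lexx.
have t1 : t <= 1 by rewrite /t !ge_min lexx orbT.
have te : t * (B + 1) <= e by rewrite -ler_pdivlMr // /t ge_min lexx orbT.
have := uM 2%N t; rewrite exp_coeffMl (ltW t0) t1 => /(_ isT).
rewrite ut0 ?t0 //= sub0r /psum 2!big_ord_recr big_ord0 /= c0 mul0r addr0 add0r.
rewrite expr1 normcN ComplexField.Normc.normcM (normc_real (ltW t0)).
move=> h.
have {}h : normc (c 1%N) * t <= B * t * t.
  apply: le_trans h _; rewrite /B /exp_coeff /= (_ : 2`! = 2%N) //.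
  by rewrite le_eqVlt; apply/orP; left; apply/eqP; field.
have : normc (c 1%N) <= B * t by rewrite -(ler_pM2r t0).
move/le_trans; apply; apply: le_trans te; rewrite mulrC ler_pM2l //.
by rewrite lerDl.
Qed.

Lemma power_series_expansion c K : 0 <= K ->
  (forall n, normc (c n) <= exp_coeff K n) -> exists u, expansion u c.
Proof.
move=> K0 cK.
pose b (f : C -> R) t n := f (c n) * t ^+ n.
have psumE t n : psum c t n =
    (series (b (@complex.Re R) t) n +i* series (b (@complex.Im R) t) n)%C.
  elim: n => [|n IHn]; first by rewrite /psum /series /= big_ord0 !big_nil.
  rewrite psumS IHn /series /= !big_nat_recr //= /b -rmorphXn.
  by case: (c n) => x y /=; simpc.
exists (fun t => limn (series (b (@complex.Re R) t)) +i*
          limn (series (b (@complex.Im R) t)))%C.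
(* The real and imaginary parts are summed as real series; each contributes a tail with factor
   [expR K], whence the 2. *)
exists (2 * expR K), K; split => //; first by rewrite mulr_ge0 ?expR_ge0.
  move=> n; rewrite (le_trans (cK n)) // ler_peMl ?exp_coeff_ge0 //.
  have : 1 <= expR K by rewrite -expR0 ler_expR.
  by lra.
move=> n t /andP[t0 t1]; have Kt : 0 <= K * t by rewrite mulr_ge0.
have KtK : K * t <= K by rewrite ler_piMr.
have bK (f : C -> R) : (forall z, `|f z| <= normc z) ->
    forall k, `|b f t k| <= exp_coeff (K * t) k.
  move=> fz k; rewrite exp_coeffMl normrM [X in _ * X]ger0_norm ?exprn_ge0 //.
  by rewrite ler_wpM2r ?exprn_ge0 // (le_trans (fz _)).
rewrite psumE (le_trans (normc_le_ReIm _)) //=.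
have rem f : (forall z, `|f z| <= normc z) ->
    `|limn (series (b f t)) - series (b f t) n| <= expR K * exp_coeff (K * t) n.
  move=> fz; rewrite (le_trans (series_exp_remainder n Kt (bK f fz))) //.
  by rewrite ler_wpM2r ?exp_coeff_ge0 // ler_expR.
have := rem _ Re_le_normc; have := rem _ Im_le_normc.
by rewrite -mulrA; lra.
Qed.

End Expansions.

(** * The curve exp(tA) and Taylor expansions along it *)

Section MatrixExponential.
Variables (R : realType) (N : nat).
Local Notation C := (complex R).
Local Notation normc := (@ComplexField.Normc.normc R).
Local Notation M := 'M[C]_N.
Implicit Types (A : M) (F : M -> C).

Lemma normc_mx_pow A : exists2 K : R, 0 <= K &
  forall n i j, normc ((A ^+ n) i j) <= K ^+ n.
Proof.
(* The sum over all entries dominates every row sum, so each further factor A costs at most a factor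
   K. *)
pose K := \sum_i \sum_j normc (A i j).
have K0 : 0 <= K.
  by apply: sumr_ge0 => i _; apply: sumr_ge0 => j _; apply: normc_ge0.
exists K => //; elim=> [|n IHn] i j.
  rewrite !expr0 mxE; case: (i == j).
    by rewrite ComplexField.Normc.normc1.
  by rewrite ComplexField.Normc.normc0.
rewrite exprS mxE (le_trans (normc_sum _ _)) //.
apply: (@le_trans _ _ (\sum_k normc (A i k) * K ^+ n)).
  apply: ler_sum => k _; rewrite ComplexField.Normc.normcM.
  by apply: ler_wpM2l; [apply: normc_ge0|apply: IHn].
rewrite -mulr_suml exprS ler_wpM2r ?exprn_ge0 // /K [leRHS](bigD1 i) //= lerDl.
by apply: sumr_ge0 => k _; apply: sumr_ge0 => l _; apply: normc_ge0.
Qed.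

(** E(t) = exp(tA) for real t in [0, 1], known only through its Taylor expansion; other values of t
    are left free. *)
Definition is_exp A (E : R -> M) : Prop := forall i j,
  expansion (fun t => E t i j) (fun n => (A ^+ n) i j / n`!%:R).

Lemma normc_fact n : normc (n`!%:R : C) = n`!%:R.
Proof. by rewrite -(rmorph_nat (@real_complex R)) normc_real. Qed.

Lemma exists_exp A : exists E, is_exp A E.
Proof.
have [K K0 AK] := normc_mx_pow A.
have ex (i j : 'I_N) : exists u, expansion u (fun n => (A ^+ n) i j / n`!%:R).
  apply: power_series_expansion K0 _ => n.
  rewrite ComplexField.Normc.normcM ComplexField.Normc.normcV normc_fact.
  by rewrite /exp_coeff /= ler_wpM2r ?invr_ge0.
exists (fun t => \matrix_(i, j) sval (cid (ex i j)) t) => i j.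
under eq_fun do rewrite mxE.
exact: svalP (cid (ex i j)).
Qed.

Variables (A : M) (E : R -> M).
Hypothesis AE : is_exp A E.

(** The derivative of F(exp(tA)) is that of F along the left-invariant field of A. Formally, the
    Leibniz rule divided by n! is the Cauchy product of the coefficients. *)
Lemma expansion_poly_fun F : poly_fun F ->
  expansion (F \o E) (fun n => iter n (lderiv A) F 1%:M / n`!%:R).
Proof.
move: F; apply: poly_fun_ind => [c|i j|F H pF pH eF eH|F H pF pH eF eH].
- have := expansion_cst c; congr (expansion _ _); apply/funext => n.
  rewrite iter_lderiv_cst.
  by case: n => [|n]; rewrite ?mul0r // fact0 divr1.
- have := AE i j; congr (expansion _ _); apply/funext => n.
  by rewrite iter_lderiv_entry mul1mx.
- have [rF rH] := (poly_fun_regular pF, poly_fun_regular pH).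
  have := expansionD eF eH; congr (expansion _ _); apply/funext => n.
  by rewrite iter_lderivD ?unitmx1 // mulrDl.
- have [rF rH] := (poly_fun_regular pF, poly_fun_regular pH).
  have := expansionM eF eH; congr (expansion _ _); apply/funext => n.
  rewrite iter_lderivM ?unitmx1 // mulr_suml; apply: eq_bigr => i _.
  have fn0 m : m`!%:R != 0 :> C by rewrite pnatr_eq0 -lt0n fact_gt0.
  have ni : (i <= n)%N by rewrite -ltnS.
  rewrite -[_ *+ 'C(n, i)]mulr_natr -(bin_fact ni) !natrM.
  have b0 : 'C(n, i)%:R != 0 :> C by rewrite pnatr_eq0 -lt0n bin_gt0.
  move: b0 (fn0 i) (fn0 (n - i)%N); set c := _%:R; set d := _%:R; set e := _%:R.
  by move=> c0 d0 e0; field; rewrite c0 d0 e0.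
Qed.

Lemma exp_unitmx : exists2 r : R, 0 < r <= 1 &
  forall t, 0 <= t <= r -> E t \in unitmx.
Proof.
have [B [K [B0 K0 _ uM]]] := expansion_poly_fun (poly_fun_det C N 1).
have BK : 0 < B * K + 1 by rewrite ltr_wpDl // mulr_ge0.
(* The remainder of order 1 bounds |det E(t) - 1| by BKt, and this radius keeps BKt below 1. *)
exists (Num.min 1 ((B * K + 1)^-1 / 2)).
  by rewrite lt_min ltr01 divr_gt0 ?invr_gt0 // ge_min lexx.
move=> t /andP[t0]; rewrite le_min => /andP[t1 tB].
have := uM 1%N t; rewrite t0 t1 => /(_ isT).
rewrite /psum big_ord1 /= det1 expr0 expr1n fact0 divr1 mulr1.
rewrite /exp_coeff /= expr1 (_ : 1`! = 1%N) // divr1 => h.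
rewrite unitmxE unitfE; apply: contraTneq h => ->.
rewrite sub0r normcN ComplexField.Normc.normc1 -ltNge.
have : t * (B * K + 1) <= 1 / 2.
  by rewrite -ler_pdivlMr // (le_trans tB) // mulrC div1r.
nra.
Qed.

(** By Leibniz, the numerator P = det^m F also has vanishing Taylor coefficients, so P vanishes
    along the curve, and det is nonzero there. *)
Lemma regular_exp_eq0 F t : regular_GL F ->
  (forall n, iter n (lderiv A) F 1%:M = 0) ->
  0 <= t <= 1 -> E t \in unitmx -> F (E t) = 0.
Proof.
move=> rF F0 t01 EU; have [P pP [m PF]] := regular_GL_clear rF.
have P0 : P (E t) = 0.
  apply: (expansion_eq0 (expansion_poly_fun pP)) t01 => n.
  rewrite (iter_lderiv_ext _ _ (H := (fun g => \det g ^+ m) \* F)) ?unitmx1 //.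
  rewrite iter_lderivM ?unitmx1 //; last exact: regular_det.
  by rewrite big1 ?mul0r // => k _; rewrite F0 mulr0 mul0rn.
have := PF _ EU; rewrite P0 => /esym/eqP; rewrite mulf_eq0.
by rewrite expf_eq0 (negPf (det_neq0 EU)) andbF => /eqP.
Qed.

(** The first Taylor coefficient of P = det^m F along the curve is zero, and it equals the
    derivative of F at 1 because det 1 = 1 and F(1) = 0. *)
Lemma lderiv_exp_eq0 F r : regular_GL F -> 0 < r <= 1 ->
  (forall t, 0 < t <= r -> E t \in unitmx /\ F (E t) = 0) ->
  F 1%:M = 0 -> lderiv A F 1%:M = 0.
Proof.
move=> rF /andP[r0 r1] EF F1; have [P pP [m PF]] := regular_GL_clear rF.
have P1 : P 1%:M = 0 by rewrite PF ?unitmx1 // F1 mulr0.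
have <- : lderiv A P 1%:M = lderiv A F 1%:M.
  rewrite (lderiv_ext _ (H := (fun g => \det g ^+ m) \* F)) ?unitmx1 //.
  rewrite lderivM ?unitmx1 //; last exact: regular_det.
  by rewrite F1 mulr0 add0r /= det1 expr1n mul1r.
have := expansion_coef1_eq0 (expansion_poly_fun pP) r0.
rewrite /= P1 mul0r (_ : 1`! = 1%N) // divr1; apply => // t /EF[EU FE].
by rewrite PF // FE mulr0.
Qed.

End MatrixExponential.

(** * Lie algebras and fixed points *)

Section LieAlgebra.
Variables (C : numFieldType) (N : nat) (G : algGroup C N).
Local Notation M := 'M[C]_N.
Local Notation pG := (points G).
Implicit Types (F H : M -> C) (A B : M) (g h : pG).

Lemma lderiv_translate F A (a x : M) :
  lderiv A (fun y => F (a *m y *m 1%:M)) x = lderiv A F (a *m x).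
Proof. by rewrite !lderivE derive_translate !mulmx1 mulmxA. Qed.

(** Left-invariant fields with A in the Lie algebra are tangent to G everywhere: x |-> F(gx)
    vanishes on G too, and is differentiated at 1. *)
Lemma lderiv_vanish A F g : lie_algebra G A -> regular_GL F ->
  (forall h, F h = 0) -> lderiv A F g = 0.
Proof.
move=> lieA rF F0.
have rT := regular_translate (points_unit g) (unitmx1 C N) rF.
have T0 h : F (g *m h *m 1%:M) = 0.
  by rewrite mulmx1; apply: (F0 (g * h)%g).
have := lieA _ rT T0; rewrite -[X in 'D_X _ _]mul1mx -lderivE.
by rewrite lderiv_translate mulmx1.
Qed.

Lemma lderiv_eq A F H g : lie_algebra G A -> regular_GL F -> regular_GL H ->
  (forall h, F h = H h) -> lderiv A F g = lderiv A H g.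
Proof.
move=> lieA rF rH FH; apply/eqP; rewrite -subr_eq0 -lderivB ?points_unit //.
rewrite lderiv_vanish //; first exact: regularB.
by move=> h; rewrite /= FH subrr.
Qed.

Lemma lie_algebraP A : lie_algebra G A <->
  forall F, regular_GL F -> (forall h, F h = 0) -> lderiv A F 1%:M = 0.
Proof.
by split=> lieA F rF F0; have := lieA F rF F0; rewrite lderivE mul1mx.
Qed.

Lemma lie_algebra_commutator A B : lie_algebra G A -> lie_algebra G B ->
  lie_algebra G (A *m B - B *m A).
Proof.
move=> lieA lieB; apply/lie_algebraP => F rF F0.
rewrite -lderiv_commutator ?unitmx1 //.
rewrite !(lderiv_vanish (1%g : pG)) ?subrr //; try exact: regular_lderiv.
- by move=> h; apply: lderiv_vanish.
- by move=> h; apply: lderiv_vanish.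
Qed.

Lemma xget_extends (Psi : pG -> M) : regular_mx Psi ->
  extends_mx (xget (fun=> 0) [set F | extends_mx F Psi]) Psi.
Proof. exact: xgetPex. Qed.

(** The extension picked by [xget] and F agree on G, and gA is tangent to G, so either may be
    used. *)
Lemma diff_mxE (Psi : pG -> M) (F : M -> M) g A i j :
  lie_algebra G A -> extends_mx F Psi ->
  diff_mx Psi g (g *m A) i j = lderiv A (fun x => F x i j) g.
Proof.
move=> lieA exF.
have [rX eX] : extends_mx (xget (fun=> 0) [set F | extends_mx F Psi]) Psi.
  by apply: xget_extends; exists F.
rewrite /diff_mx derive_mxE ?points_unit // -lderivE; apply: lderiv_eq => //.
  by case: exF => rF _.
by move=> h; case: exF => _ eF; rewrite eX eF.
Qed.

(** * Derivatives of the involution *)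

Section Theta.
Variable theta : pG -> pG.
Hypothesis thetaM : {morph theta : g h / (g * h)%g}.
Variable Th : M -> M.
Hypothesis exTh : extends_mx Th (fun g => theta g : M).

Let rTh i j : regular_GL (fun x : M => Th x i j). Proof. by case: exTh. Qed.
Let ThE g : Th g = theta g. Proof. by case: exTh. Qed.

Lemma theta1 : theta 1%g = 1%g.
Proof.
have e := thetaM 1%g 1%g; rewrite mulg1 in e.
by apply: (@mulgI _ (theta 1%g)); rewrite -e mulg1.
Qed.

(** Differentiate theta(gx) = theta(g) theta(x) at x = 1 in the direction A. *)
Lemma lderiv_theta A g i j : lie_algebra G A ->
  lderiv A (fun x => Th x i j) g =
  (Th g *m diff_mx (fun h => theta h : M) (1%g : pG) A) i j.
Proof.
move=> lieA.
have := lderiv_translate (fun x => Th x i j) A g 1%:M; rewrite mulmx1 => <-.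
have rT := regular_translate (points_unit g) (unitmx1 C N) (rTh i j).
have rZ k := regularZ (Th g i k) (rTh k j).
rewrite (@lderiv_eq A _ (fun x => \sum_k Th g i k * Th x k j) (1%g : pG)) //.
- rewrite lderiv_sum ?unitmx1 // mxE; apply: eq_bigr => k _.
  rewrite lderivZ ?unitmx1 //; congr (_ * _).
  by rewrite -(@diff_mxE _ _ 1%g A k j lieA exTh) mul1mx.
- exact: regular_sum.
- move=> h; rewrite mulmx1 !ThE.
  by have := ThE (g * h)%g; rewrite thetaM => ->; rewrite mxE.
Qed.

(** Differentiating theta along two elements of p produces two minus signs, which cancel;
    antisymmetrizing shows that [A, B] is fixed by the differential of theta. *)
Lemma lie_p_commutator A B : lie_p theta A -> lie_p theta B ->
  forall g i j, lderiv (A *m B - B *m A) (fun x => Th x i j) g =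
    (Th g *m (A *m B - B *m A)) i j.
Proof.
move=> [lieA pA] [lieB pB] g i j.
have LL D E : lie_algebra G D -> lie_algebra G E ->
    diff_mx (fun h => theta h : M) (1%g : pG) D = - D ->
    diff_mx (fun h => theta h : M) (1%g : pG) E = - E ->
    lderiv D (lderiv E (fun x => Th x i j)) g = (Th g *m (D *m E)) i j.
  move=> lieD lieE pD pE.
  rewrite (@lderiv_eq D _ (fun x => \sum_k - E k j * Th x i k) g) //.
  - rewrite lderiv_sum ?points_unit //; last first.
      by move=> k; apply: (regularZ (- E k j)) (rTh i k).
    rewrite mulmxA mxE; apply: eq_bigr => k _.
    rewrite (lderivZ D (- E k j)) ?points_unit // lderiv_theta // pD mulmxN mxE.
    by rewrite mulrNN mulrC.
  - exact: regular_lderiv.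
  - by apply: regular_sum => k; apply: (regularZ (- E k j)) (rTh i k).
  - move=> h; rewrite lderiv_theta // pE mulmxN !mxE -sumrN.
    by apply: eq_bigr => k _; rewrite mulNr mulrC.
by rewrite -lderiv_commutator ?points_unit // !LL // mulmxBr !mxE.
Qed.

(** At g = 1 these are the entries of A^n, so theta(exp(tA)) and exp(tA) have the same Taylor
    coefficients. *)
Lemma iter_lderiv_theta A n g i j : lie_algebra G A ->
  (forall g i j, lderiv A (fun x => Th x i j) g = (Th g *m A) i j) ->
  iter n (lderiv A) (fun x => Th x i j) g = (Th g *m A ^+ n) i j.
Proof.
move=> lieA AT; elim: n g => [|n IHn] g /=; first by rewrite expr0 mulmx1.
rewrite (@lderiv_eq A _ (fun x => \sum_k (A ^+ n) k j * Th x i k) g) //.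
- rewrite lderiv_sum ?points_unit //; last first.
    by move=> k; apply: (regularZ ((A ^+ n) k j)) (rTh i k).
  rewrite exprS -[A * _]/(A *m _) mulmxA [RHS]mxE; apply: eq_bigr => k _.
  by rewrite (lderivZ A ((A ^+ n) k j)) ?points_unit // AT mulrC.
- exact: regular_iter_lderiv.
- by apply: regular_sum => k; apply: (regularZ ((A ^+ n) k j)) (rTh i k).
- by move=> h; rewrite IHn mxE; apply: eq_bigr => k _; rewrite mulrC.
Qed.

End Theta.

End LieAlgebra.

(** * Exponentials in K and right K-invariant functions *)

Section FixedGroup.
Variables (R : realType) (N : nat).
Local Notation C := (complex R).
Variables (G : algGroup C N) (theta : points G -> points G).
Local Notation M := 'M[C]_N.
Hypothesis thetaM : {morph theta : g h / (g * h)%g}.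
Variable Th : M -> M.
Hypothesis exTh : extends_mx Th (fun g : points G => theta g : M).
Implicit Types (g h k : points G).

Lemma lderiv_fixed_invariant A f F g : lie_algebra G A ->
  (forall g i j, lderiv A (fun x => Th x i j) g = (Th g *m A) i j) ->
  regular_GK theta f -> extends F f -> lderiv A F g = 0.
Proof.
move=> lieA AT [_ fK] [rF Ff].
have [E AE] := exists_exp A; have [r r01 EU] := exp_unitmx AE.
have /andP[r0 r1] := r01.
have t01 t : 0 < t <= r -> 0 <= t <= 1.
  by move=> /andP[t0 tr]; rewrite ltW //= (le_trans tr).
have tEU t : 0 < t <= r -> E t \in unitmx.
  by move=> /andP[t0 tr]; apply: EU; rewrite ltW.
have EK t : 0 < t <= r -> exists2 k : points G, (k : M) = E t & theta k = k.
  move=> tr; have [S [sS defG]] := alg_closed G.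
  have GE : alg_set G (E t).
    rewrite defG; split=> [|H SH]; first exact: tEU.
    have rH := sS _ SH.
    (* The induction needs vanishing on all of G, since each step differentiates the previous
       function along G. *)
    have H0 n h : iter n (lderiv A) H h = 0.
      elim: n h => [|n IHn] h /=.
        by have := points_in h; rewrite {1}defG => -[_]; apply.
      by apply: lderiv_vanish => //; apply: regular_iter_lderiv.
    apply: (regular_exp_eq0 AE) => //; [|exact: t01|exact: tEU].
    by move=> n; apply: (H0 n 1%g).
  exists (Point (E t) (mem_set GE)) => //; apply: val_inj => /=.
  have [rTh ThE] := exTh; rewrite -ThE; apply/matrixP => i j.
  have rD : regular_GL ((fun x => Th x i j) \- mx_entry i j).
    by apply: regularB; [apply: rTh|apply: regular_entry].
  apply/eqP; rewrite -subr_eq0; apply/eqP.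
  apply: (regular_exp_eq0 AE rD); [|exact: t01|exact: tEU].
  move=> n; rewrite iter_lderivB ?unitmx1 //; last exact: regular_entry.
  have := iter_lderiv_theta exTh n 1%g i j lieA AT => /= ->.
  have -> : Th 1%:M = 1%:M by have := ThE 1%g; rewrite (theta1 thetaM).
  by rewrite iter_lderiv_entry subrr.
have rT := regular_translate (points_unit g) (unitmx1 C N) rF.
have rC : regular_GL (fun _ : M => F g) by apply: regular_cst.
(* F(gx) - F(g) vanishes at x = 1 and at x = exp(tA), which lies in K for small t; subtracting the
   constant does not change the derivative. *)
have := lderiv_exp_eq0 AE (regularB rT rC) r01.
rewrite lderivB ?unitmx1 // lderiv_cst subr0 lderiv_translate mulmx1; apply.
  move=> t tr; split; first exact: tEU.
  have [k <- kK] := EK t tr; rewrite /= mulmx1.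
  have -> : F (g *m k) = f (g * k)%g by rewrite -Ff.
  by rewrite fK // Ff subrr.
by rewrite /= !mulmx1 subrr.
Qed.

End FixedGroup.

(** * Commutators of vector fields *)

Section Circledast.
Variables (C : numFieldType) (N : nat) (G : algGroup C N).
Local Notation M := 'M[C]_N.
Local Notation pG := (points G).
Implicit Types (F : M -> C) (A B : M) (g h k : pG) (Phi Psi : pG -> M).

(** A linear equation with constant coefficients satisfied by all values of Psi passes to its
    derivatives along G. *)
Lemma diff_mx_linear (c : 'I_N -> 'I_N -> C) Psi A g :
  lie_algebra G A -> regular_mx Psi ->
  (forall h, \sum_i \sum_j Psi h i j * c i j = 0) ->
  \sum_i \sum_j diff_mx Psi g (g *m A) i j * c i j = 0.
Proof.
move=> lieA [P exP] c0; have [rP PE] := exP.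
have rc i j : regular_GL (fun x => P x i j * c i j).
  by apply: (regularM (rP i j)); apply: regular_cst.
have rs i : regular_GL (fun x => \sum_j P x i j * c i j) by apply: regular_sum.
rewrite -[RHS](@lderiv_vanish _ _ _ A
  (fun x => \sum_i \sum_j P x i j * c i j) g) //.
- rewrite lderiv_sum ?points_unit //; apply: eq_bigr => i _.
  rewrite lderiv_sum ?points_unit //; apply: eq_bigr => j _.
  have rC : regular_GL (fun _ : M => c i j) by apply: regular_cst.
  rewrite (lderivM A (rP i j) rC) ?points_unit // lderiv_cst mulr0 addr0.
  by rewrite (diff_mxE _ _ _ lieA exP).
- exact: regular_sum.
- by move=> h; rewrite -[RHS](c0 h) PE.
Qed.

(** The product rule: the first term comes from differentiating the coefficients [P x i j], the
    second from freezing them at g. *)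
Lemma lderiv_variable F (P : M -> M) Psi A g : lie_algebra G A ->
  regular_GL F -> extends_mx P Psi ->
  lderiv A (fun x => \sum_i \sum_j P x i j * lderiv (delta_mx i j) F x) g =
  lderiv (diff_mx Psi g (g *m A)) F g + lderiv A (lderiv (Psi g) F) g.
Proof.
move=> lieA rF exP; have [rP PE] := exP; have gU := points_unit g.
have rL i j := regular_lderiv (delta_mx i j) rF.
have rM i j := regularM (rP i j) (rL i j).
have rB B i j : regular_GL (fun x => B i j * lderiv (delta_mx i j) F x).
  exact: (regularZ (B i j) (rL i j)).
rewrite lderiv_sum //; last by move=> i; apply: regular_sum => j; apply: rM.
rewrite (lderiv_delta (diff_mx Psi g _)) //.
rewrite (lderiv_ext A (H := fun x =>
  \sum_i \sum_j Psi g i j * lderiv (delta_mx i j) F x)) //; last first.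
  by move=> x xU; apply: lderiv_delta.
rewrite lderiv_sum //; last by move=> i; apply: regular_sum => j; apply: rB.
rewrite -big_split; apply: eq_bigr => i _ /=.
rewrite lderiv_sum //; last by move=> j; apply: rM.
rewrite lderiv_sum //.
rewrite -big_split; apply: eq_bigr => j _ /=.
rewrite (lderivM A (rP i j) (rL i j)) // (diff_mxE _ _ _ lieA exP) PE.
by rewrite (lderivZ A (Psi g i j)).
Qed.

Variable theta : pG -> pG.
Hypothesis thetaP : involutive_automorphism theta.

Lemma lie_pB A B : lie_p theta A -> lie_p theta B -> lie_p theta (A - B).
Proof.
have [_ _ [Th exTh]] := thetaP; have [rTh _] := exTh.
move=> [lieA pA] [lieB pB].
have lieAB : lie_algebra G (A - B).
  apply/lie_algebraP => F rF F0; rewrite lderivBl ?unitmx1 //.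
  by rewrite !(lderiv_vanish (1%g : pG)) ?subrr.
split => //; apply/matrixP => i j.
have dE D : lie_algebra G D ->
    diff_mx (fun h => theta h : M) (1%g : pG) D i j =
    lderiv D (fun x => Th x i j) 1%:M.
  by move=> lieD; rewrite -(@diff_mxE _ _ _ _ _ 1%g D i j lieD exTh) mul1mx.
by rewrite dE // lderivBl ?unitmx1 // -!dE // pA pB !mxE; ring.
Qed.

(** p is cut out by linear equations: one for each regular F vanishing on G, and the entries of
    dtheta(B) + B = 0. Each passes to the derivative by [diff_mx_linear]. *)
Lemma diff_mx_lie_p Psi A g : lie_algebra G A -> regular_mx Psi ->
  (forall h, lie_p theta (Psi h)) -> lie_p theta (diff_mx Psi g (g *m A)).
Proof.
have [_ _ [Th exTh]] := thetaP; have [rTh _] := exTh.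
move=> lieA rPsi pPsi; set D := diff_mx _ _ _.
have lieD : lie_algebra G D.
  apply/lie_algebraP => F rF F0; rewrite lderiv_delta ?unitmx1 //.
  apply: (diff_mx_linear _ lieA rPsi) => h.
  rewrite -lderiv_delta ?unitmx1 //; apply: (lderiv_vanish (1%g : pG)) => //.
  by have [] := pPsi h.
have dE B i j : lie_algebra G B ->
    diff_mx (fun h => theta h : M) (1%g : pG) B i j =
    \sum_k \sum_l B k l * lderiv (delta_mx k l) (fun x => Th x i j) 1%:M.
  move=> lieB; rewrite -lderiv_delta ?unitmx1 //.
  by rewrite -(@diff_mxE _ _ _ _ _ 1%g B i j lieB exTh) mul1mx.
have entryE B i j : \sum_k \sum_l B k l * (delta_mx i j : M) k l = B i j.
  rewrite (bigD1 i) //= [X in _ + X]big1 ?addr0; last first.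
    by move=> k /negPf ki; rewrite big1 // => l _; rewrite mxE ki mulr0.
  rewrite (bigD1 j) //= mxE !eqxx mulr1 big1 ?addr0 //.
  by move=> l /negPf lj; rewrite mxE lj andbF mulr0.
have sumE B i j : lie_algebra G B ->
    \sum_k \sum_l B k l * (lderiv (delta_mx k l) (fun x => Th x i j) 1%:M
       + (delta_mx i j : M) k l) =
    diff_mx (fun h => theta h : M) (1%g : pG) B i j + B i j.
  move=> lieB; rewrite dE // -[X in _ = _ + X](entryE B) -big_split.
  apply: eq_bigr => k _ /=; rewrite -big_split; apply: eq_bigr => l _.
  by rewrite /= mulrDr.
split => //; apply/matrixP => i j.
apply/eqP; rewrite mxE -subr_eq0 opprK -sumE //; apply/eqP.
apply: (diff_mx_linear _ lieA rPsi) => h; have [lieh ph] := pPsi h.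
by rewrite sumE // ph mxE addNr.
Qed.

(** Differentiate Psi(hk) = Ad(k^-1) Psi(h) in h at g, along g Phi(g). *)
Lemma diff_mx_isotropy Phi Psi g k : induced theta Phi -> induced theta Psi ->
  fixed_group theta k ->
  diff_mx Psi (g * k)%g ((g * k)%g *m Phi (g * k)%g) =
  isotropy k^-1%g (diff_mx Psi g (g *m Phi g)).
Proof.
move=> [_ pPhi ePhi] [[P exP] pPsi ePsi] kK; have [rP PE] := exP.
have [lieg _] := pPhi g; have [liegk _] := pPhi (g * k)%g.
apply/matrixP => i j; rewrite (diff_mxE _ _ _ liegk exP) lderivE.
(* Equivariance of Phi shows that right translation by k carries the tangent vector g Phi(g) to gk
   Phi(gk). *)
have -> : (g * k)%g *m Phi (g * k)%g = 1%:M *m (g *m Phi g) *m k.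
  rewrite ePhi // /isotropy invgK mul1mx /= !mulmxA.
  by rewrite -[g *m k *m _]mulmxA mulmxV ?points_unit // mulmx1.
have -> : ((g * k)%g : M) = 1%:M *m g *m k by rewrite mul1mx.
rewrite -(derive_translate (fun x => P x i j)) -lderivE.
pose c := ((k^-1)%g : M).
rewrite (@lderiv_eq _ _ _ _ _ (fun x =>
  \sum_l \sum_m (c i m * k l j) * P x m l) g lieg).
- rewrite lderiv_sum ?points_unit //; last first.
    by move=> l; apply: regular_sum => m; apply: (regularZ (c i m * k l j)).
  rewrite /isotropy invgK mxE; apply: eq_bigr => l _.
  rewrite lderiv_sum ?points_unit //; last first.
    by move=> m; apply: (regularZ (c i m * k l j)).
  rewrite mxE mulr_suml; apply: eq_bigr => m _.
  rewrite (lderivZ _ (c i m * k l j)) ?points_unit // (diff_mxE _ _ _ lieg exP).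
  by rewrite mulrAC.
- exact: (regular_translate (unitmx1 C N) (points_unit k) (rP i j)).
- apply: regular_sum => l; apply: regular_sum => m.
  exact: (regularZ (c i m * k l j)).
- move=> h; rewrite mul1mx; have := PE (h * k)%g => /= ->.
  rewrite ePsi // /isotropy invgK mxE; apply: eq_bigr => l _.
  by rewrite mxE mulr_suml; apply: eq_bigr => m _; rewrite PE mulrAC.
Qed.

Lemma regular_diff_mx Phi Psi : regular_mx Phi -> regular_mx Psi ->
  (forall g, lie_algebra G (Phi g)) ->
  regular_mx (fun g => diff_mx Psi g (g *m Phi g)).
Proof.
move=> [Q [rQ QE]] [P exP] lieQ; have [rP _] := exP.
(* The directional derivative is expanded over elementary matrices, with the maps replaced by
   extensions to GL_N. *)
exists (fun x => \matrix_(i, j) \sum_k \sum_l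
  Q x k l * lderiv (delta_mx k l) (fun y => P y i j) x); split.
  move=> i j; under eq_fun do rewrite mxE.
  apply: regular_sum => k; apply: regular_sum => l.
  by apply: (regularM (rQ k l)); apply: regular_lderiv.
move=> g; apply/matrixP => i j; rewrite mxE (diff_mxE _ _ _ (lieQ g) exP).
by rewrite [RHS]lderiv_delta ?points_unit // QE.
Qed.

Lemma regular_mxB Phi Psi : regular_mx Phi -> regular_mx Psi ->
  regular_mx (fun g => Phi g - Psi g).
Proof.
move=> [P [rP PE]] [Q [rQ QE]]; exists (fun x => P x - Q x); split.
  move=> i j; apply: regular_GL_ext (regularB (rP i j) (rQ i j)) => x _.
  by rewrite /= !mxE.
by move=> g; rewrite PE QE.
Qed.

Lemma induced_circledast Phi Psi : induced theta Phi -> induced theta Psi ->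
  induced theta (circledast Phi Psi).
Proof.
move=> iPhi iPsi; have [rPhi pPhi ePhi] := iPhi; have [rPsi pPsi ePsi] := iPsi.
have liePhi g : lie_algebra G (Phi g) by have [] := pPhi g.
have liePsi g : lie_algebra G (Psi g) by have [] := pPsi g.
split.
- by apply: regular_mxB; apply: regular_diff_mx.
- by move=> g; apply: lie_pB; apply: diff_mx_lie_p.
- move=> g k kK; rewrite /circledast (diff_mx_isotropy _ iPhi iPsi) //.
  rewrite (diff_mx_isotropy _ iPsi iPhi) // /isotropy.
  by rewrite mulmxBr mulmxBl.
Qed.

Lemma regular_GKB (f h : pG -> C) : regular_GK theta f -> regular_GK theta h ->
  regular_GK theta (f \- h).
Proof.
move=> [[F [rF Ff]] fK] [[H [rH Hh]] hK]; split.
  exists (F \- H); split; first exact: regularB.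
  by move=> g; rewrite /= Ff Hh.
by move=> g k kK; rewrite /= fK ?hK.
Qed.

Lemma regular_GKM (f h : pG -> C) : regular_GK theta f -> regular_GK theta h ->
  regular_GK theta (f \* h).
Proof.
move=> [[F [rF Ff]] fK] [[H [rH Hh]] hK]; split.
  exists (F \* H); split; first exact: regularM.
  by move=> g; rewrite /= Ff Hh.
by move=> g k kK; rewrite /= fK ?hK.
Qed.

Lemma vector_field_commutator X Y : vector_field theta X ->
  vector_field theta Y -> vector_field theta (commutator X Y).
Proof.
move=> [rX linX leibX] [rY linY leibY].
have addX (f h : pG -> C) : regular_GK theta f -> regular_GK theta h ->
    X (f \+ h) = X f \+ X h.
  move=> rf rh; have := linX 1 f h rf rh.
  have e (u : pG -> C) : 1 \*o u = u by apply/funext => g; apply: mul1r.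
  by rewrite !e.
have addY (f h : pG -> C) : regular_GK theta f -> regular_GK theta h ->
    Y (f \+ h) = Y f \+ Y h.
  move=> rf rh; have := linY 1 f h rf rh.
  have e (u : pG -> C) : 1 \*o u = u by apply/funext => g; apply: mul1r.
  by rewrite !e.
split.
- by move=> f rf; apply: regular_GKB; [apply/rX/rY|apply/rY/rX].
- move=> a f h rf rh; rewrite /commutator linX // linY // linX ?linY //;
    try by [apply: rX|apply: rY].
  by apply/funext => g /=; ring.
- move=> f h rf rh; have [rXf rXh] := (rX _ rf, rX _ rh).
  have [rYf rYh] := (rY _ rf, rY _ rh).
  rewrite /commutator leibX // leibY // addX ?addY ?leibX ?leibY //;
    try exact: regular_GKM.
  by apply/funext => g /=; ring.
Qed.

End Circledast.

(** * Second-order terms of the compositions and their cancellation *)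

Theorem proposition3p1 (R : realType) (N : nat) (G : algGroup (R[i])%C N)
    (G_connected : zariski_connected G) (G_reductive : reductive G)
    (theta : points G -> points G)
    (theta_inv : involutive_automorphism theta)
    (X Y : (points G -> (R[i])%C) -> points G -> (R[i])%C)
    (Phi Psi : points G -> 'M[(R[i])%C]_N)
    (X_Phi : corresponds theta X Phi) (Y_Psi : corresponds theta Y Psi) :
  corresponds theta (commutator X Y) (circledast Phi Psi).
Proof.
have [vX iPhi XE] := X_Phi; have [vY iPsi YE] := Y_Psi.
have [thetaM _ [Th exTh]] := theta_inv.
have [rPhi pPhi _] := iPhi; have [rPsi pPsi _] := iPsi.
split; [exact: vector_field_commutator|exact: induced_circledast|].
move=> f F rf exF g; rewrite derive1_curve; have [rF _] := exF.
have comp X1 Y1 Phi1 Psi1 : corresponds theta X1 Phi1 ->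
    corresponds theta Y1 Psi1 -> X1 (Y1 f) g =
    lderiv (diff_mx Psi1 g (g *m Phi1 g)) F g +
    lderiv (Phi1 g) (lderiv (Psi1 g) F) g.
  move=> [_ [_ pPhi1 _] XE1] [[rY1 _ _] [[P exP] pPsi1 _] YE1].
  have [lie1 _] := pPhi1 g; have [rP PE] := exP.
  rewrite -(lderiv_variable g lie1 rF exP) -derive1_curve.
  (* This regular function on GL_N extends [Y1 f], so the formula for [X1] applies to it. *)
  apply: (XE1 _ (fun x => \sum_i \sum_j P x i j * lderiv (delta_mx i j) F x)).
    exact: rY1.
  split.
    apply: regular_sum => i; apply: regular_sum => j.
    by apply: (regularM (rP i j)); apply: regular_lderiv.
  move=> h; rewrite (YE1 _ _ rf exF) derive1_curve.
  by rewrite [RHS]lderiv_delta ?points_unit // PE.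
rewrite /commutator /= (comp X Y Phi Psi) // (comp Y X Psi Phi) //.
have [lieA _] := pPhi g; have [lieB _] := pPsi g.
have gU := points_unit g.
(* The bracket of two elements of p is tangent to K, along which f is constant; hence the
   second-order terms of XY and YX agree. *)
have K0 : lderiv (Phi g *m Psi g - Psi g *m Phi g) F g = 0.
  apply: (lderiv_fixed_invariant thetaM exTh g _ _ rf exF).
    exact: (lie_algebra_commutator lieA lieB).
  exact: (lie_p_commutator thetaM exTh (pPhi g) (pPsi g)).
have L12 : lderiv (Phi g) (lderiv (Psi g) F) g =
    lderiv (Psi g) (lderiv (Phi g) F) g.
  by apply: subr0_eq; rewrite lderiv_commutator.
have arith (a b c : complex R) : a + c - (b + c) = a - b by ring.
by rewrite L12 arith -lderivBl.
Qed.
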